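(* For every integer $n\ge 3$, let $CL_n$ denote the circular ladder of length $n$. Then $$\chi_\rho(CL_n)=\begin{cases} 5 & \text{if } n=3, \text{ or } n \text{ is even and } n\notin\{8,14\},\\ 7 & \text{if } n\in\{7,8,9\},\\ 6 & \text{otherwise.}\end{cases}$$
   Context: All graphs are simple. For a graph $G$, $d_G(u,v)$ is the number of edges of a shortest path between $u$ and $v$. A packing $k$-colouring of $G$ is a map $\pi:V(G)\to\{1,\dots,k\}$ such that for any two distinct vertices $u,v$, $\pi(u)=\pi(v)=i$ implies $d_G(u,v)>i$. The packing chromatic number $\chi_\rho(G)$ is the smallest $k$ such that $G$ admits a packing $k$-colouring. The circular ladder $CL_n$ ($n\ge 3$) is the Cartesian product $C_n\,\Box\,K_2$: its vertex set is $\{u_0,\dots,u_{n-1}\}\cup\{v_0,\dots,v_{n-1}\}$ and its edges are $u_iv_i$, $u_iu_{i+1}$, $v_iv_{i+1}$ for $0\le i\le n-1$ (subscripts modulo $n$). *)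

(* Defs.v *)
(* A graph is an adjacency relation on a finType. *)
From mathcomp Require Import all_boot.

Set Implicit Arguments.
Unset Strict Implicit.
Unset Printing Implicit Defensive.

Section Packing.

Variables (T : finType) (e : rel T).

(* The number of edges of a shortest path from u to v.  A path has fewer than
   #|T| edges; if v is not reachable from u, the value is the junk #|T|. *)
Definition gdist (u v : T) : nat :=
  find (fun d => [exists p : d.-tuple T,
          [&& path e u p, last u p == v & uniq (u :: p)]])
       (iota 0 #|T|).

(* The element c of 'I_k stands for the colour c + 1 of {1, ..., k}.  The guard
   [connect e u v] makes vertices in distinct components infinitely far apart. *)
Definition packing_coloring (k : nat) (pi : {ffun T -> 'I_k}) : bool :=
  [forall u, forall v,
     [&& u != v, pi u == pi v & connect e u v] ==> ((pi u).+1 < gdist u v)].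

Definition packing_colorable (k : nat) : bool :=
  [exists pi : {ffun T -> 'I_k}, packing_coloring pi].

Lemma packing_colorable_ex : exists k, packing_colorable k.
Proof.
exists #|T|; apply/existsP; exists [ffun u => enum_rank u].
apply/forallP => u; apply/forallP => v; apply/implyP => /and3P[neq_uv].
by rewrite !ffunE (inj_eq enum_rank_inj) (negPf neq_uv).
Qed.

Definition packing_chromatic : nat := ex_minn packing_colorable_ex.

End Packing.

Definition cartesian (T1 T2 : finType) (e1 : rel T1) (e2 : rel T2) :
    rel (T1 * T2) :=
  fun x y => (e1 x.1 y.1 && (x.2 == y.2)) || ((x.1 == y.1) && e2 x.2 y.2).

(* For n >= 3 this is the n-cycle. *)
Definition cycle_graph (n : nat) : rel 'I_n :=
  fun i j => (val j == i.+1 %% n) || (val i == j.+1 %% n).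
Arguments cycle_graph : clear implicits.

Definition complete_graph (T : finType) : rel T := fun x y => x != y.
Arguments complete_graph : clear implicits.

(* u_i is (i, false) and v_i is (i, true). *)
Definition circular_ladder (n : nat) : rel ('I_n * bool) :=
  cartesian (cycle_graph n) (complete_graph bool).
Arguments circular_ladder : clear implicits.

Lemma circular_ladder_sym n : symmetric (circular_ladder n).
Proof.
move=> [i a] [j b]; rewrite /circular_ladder /cartesian /cycle_graph.
by rewrite /complete_graph /= orbC (eq_sym a) (eq_sym i) (orbC (val j == _)) orbC.
Qed.

Lemma circular_ladder_irrefl n : 3 <= n -> irreflexive (circular_ladder n).
Proof.
move=> n_ge3 [i a]; rewrite /circular_ladder /cartesian /cycle_graph.
rewrite /complete_graph /= !eqxx orbb andbT orbF; apply/negbTE.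
case: (ltngtP i.+1 n) (ltn_ord i) => // [lt_in|eq_in] _.
  by rewrite modn_small // neq_ltn ltnSn.
by rewrite eq_in modnn -lt0n -ltnS eq_in (leq_trans _ n_ge3).
Qed.

(* Main.v *)
(* The distance in CL_n is the distance along the cycle plus 1 for a change of
   row, so a packing colouring with fewer than n colours unrolls to a periodic
   packing colouring of the infinite ladder.  With four colours no six
   consecutive columns can be coloured.  With five colours, the vertices of
   colour 1 all lie in the same bipartition class of the infinite ladder, so the
   row of colour 1 alternates (in a sense that covers the columns that do not
   contain it) and n is even.

   For the upper bounds, colourings of long ladders are rings of words that
   share a six-column prefix: lengths 6 and 10 with five colours generate every
   even n > 4 except 8 and 14, and lengths 6, 11, 13 and 15 with six colours every
   odd n > 10.  The remaining values of n are settled by exhaustive search. *)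
Require Import Defs.
From mathcomp Require Import all_boot.
From mathcomp Require Import zify.

Set Implicit Arguments.
Unset Strict Implicit.
Unset Printing Implicit Defensive.

(** * Distances in the circular ladder *)

Definition cycle_dist (n i j : nat) : nat :=
  minn ((i - j) + (j - i)) (n - ((i - j) + (j - i))).

Definition ladder_dist (n : nat) (u v : 'I_n * bool) : nat :=
  cycle_dist n u.1 v.1 + (u.2 != v.2).

Lemma cycle_dist_step n (i j k : 'I_n) :
  cycle_graph n i j -> cycle_dist n i k <= (cycle_dist n j k).+1.
Proof.
have nextE (x : 'I_n) : x.+1 %% n = if x.+1 == n then 0 else x.+1.
  case: eqP => [->|ne]; first by rewrite modnn.
  by rewrite modn_small //; have := ltn_ord x; lia.
rewrite /cycle_graph /cycle_dist /= !nextE.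
move: (ltn_ord i) (ltn_ord j) (ltn_ord k).
by case: ifP; case: ifP; lia.
Qed.

Lemma cycle_dist_descent n (i j : 'I_n) d :
  cycle_dist n i j = d.+1 -> exists2 k, cycle_graph n i k & cycle_dist n k j = d.
Proof.
have n_gt0 : 0 < n by case: (n) i => [[]|].
have [/= ltin ltjn] := (ltn_ord i, ltn_ord j).
pose next := Ordinal (ltn_pmod i.+1 n_gt0).
have lt_prev : (if i == 0 :> nat then n.-1 else i.-1) < n by case: eqP; lia.
pose prev := Ordinal lt_prev.
have nextE : next = (if i.+1 == n then 0 else i.+1) :> nat.
  rewrite /=; case: eqP => [->|ne]; first by rewrite modnn.
  by rewrite modn_small //; lia.
have prevE : i = prev.+1 %% n :> nat.
  rewrite /=; case: eqP => [->|ne]; first by rewrite prednK // modnn.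
  by rewrite prednK ?modn_small //; lia.
(* The test asks whether the forward arc from [i] to [j] is no longer than the backward one; a step
   along the chosen arc lowers the distance by one. *)
have [fwd|bwd] := boolP (if i <= j then j - i <= n - (j - i)
                                   else n - (i - j) <= i - j).
  move=> dE; exists next; first by rewrite /cycle_graph /= eqxx.
  by move: dE fwd; rewrite /cycle_dist nextE; do 2 case: ifP; lia.
move=> dE; exists prev; first by rewrite /cycle_graph -prevE eqxx orbT.
by move: dE bwd; rewrite /cycle_dist /=; case: ifP; case: eqP; lia.
Qed.

Lemma ladder_dist_path n (u : 'I_n * bool) p :
  path (circular_ladder n) u p -> ladder_dist u (last u p) <= size p.
Proof.
elim: p u => [|w p IHp] u /=; first by rewrite /ladder_dist /cycle_dist eqxx; lia.
case/andP=> uw /IHp; set v := last w p => le_wv.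
apply: (@leq_trans (ladder_dist w v).+1) => //.
move: uw v {le_wv} => + v; rewrite /circular_ladder /cartesian /ladder_dist.
case/orP=> /andP[].
  by move=> /(@cycle_dist_step _ _ _ v.1) ? /eqP->; rewrite -addSn leq_add2r.
by move=> /eqP-> _; rewrite -addnS leq_add2l; case: (_ != _).
Qed.

(** The walk changes row first if it must, then descends along the cycle. *)
Lemma ladder_dist_walk n (u v : 'I_n * bool) :
  exists p, [/\ path (circular_ladder n) u p, last u p = v
              & size p = ladder_dist u v].
Proof.
move dE: (ladder_dist u v) => d; elim: d u dE => [|d IHd] u dE.
  exists [::]; split=> //; move: u v dE => [i a] [j b] /eqP.
  rewrite /ladder_dist addn_eq0 eqb0 negbK /= => /andP[/eqP ij0 /eqP->].
  congr (_, _); apply: val_inj => /=; move: ij0 (ltn_ord i) (ltn_ord j).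
  by rewrite /cycle_dist; lia.
suff [w uw /IHd[p [wp pv sz]]] :
    exists2 w, circular_ladder n u w & ladder_dist w v = d.
  by exists (w :: p); rewrite /= uw wp sz.
move: u v dE {IHd} => [i a] [j b]; rewrite /ladder_dist /=.
have [<-|neq_ab] := altP (a =P b).
  rewrite addn0 => /cycle_dist_descent[k ik kj]; exists (k, a) => /=.
    by rewrite /circular_ladder /cartesian /= ik eqxx.
  by rewrite kj eqxx addn0.
rewrite addn1 => -[ijd]; exists (i, b) => /=; last by rewrite eqxx addn0.
by rewrite /circular_ladder /cartesian /complete_graph /= neq_ab eqxx orbT.
Qed.

(** A repetition-free shortening of [p] has fewer than [#|T|] edges, so its length lies in the range
    that [gdist] searches. *)
Lemma gdist_le_path (T : finType) (e : rel T) u p :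
  path e u p -> gdist e u (last u p) <= size p.
Proof.
case/shortenP=> p' up' uniq_p' sub_p'; set v := last u p'.
have lt_sz : size p' < #|T|.
  by rewrite -[(size p').+1]/(size (u :: p')) -(card_uniqP uniq_p') max_card.
have reach : [exists q : (size p').-tuple T,
    [&& path e u q, last u q == v & uniq (u :: q)]].
  by apply/existsP; exists (in_tuple p'); rewrite up' eqxx.
apply: leq_trans (uniq_leq_size (proj2 (andP uniq_p')) sub_p').
rewrite /gdist leqNgt; apply/negP => /(before_find 0).
by rewrite nth_iota // add0n reach.
Qed.

Lemma gdist_path_size (T : finType) (e : rel T) u v :
  gdist e u v < #|T| -> exists p, [/\ path e u p, last u p = v & size p = gdist e u v].
Proof.
rewrite /gdist; set P := (fun d => _) => lt_d.
have /(nth_find 0) : has P (iota 0 #|T|) by rewrite has_find size_iota.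
rewrite nth_iota // add0n.
by case/existsP=> p /and3P[up /eqP pv _]; exists p; rewrite size_tuple.
Qed.

Lemma gdist_ladder n (u v : 'I_n * bool) :
  gdist (circular_ladder n) u v = ladder_dist u v.
Proof.
have [p [up pv szp]] := ladder_dist_walk u v.
apply/eqP; rewrite eqn_leq -{1}szp -{1}pv gdist_le_path //=.
have [/gdist_path_size[q [uq <- <-]]|] :=
  ltnP (gdist (circular_ladder n) u v) #|{: 'I_n * bool}|.
  exact: ladder_dist_path.
(* If [gdist] took its junk value it would be at least [2 * n], which [ladder_dist] never
   exceeds. *)
apply: leq_trans; rewrite card_prod card_ord card_bool.
by rewrite /ladder_dist /cycle_dist; have := (ltn_ord u.1); case: (_ != _); lia.
Qed.

Lemma ladder_packingP n k (pi : {ffun 'I_n * bool -> 'I_k}) :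
  reflect (forall u v, u != v -> pi u = pi v -> (pi u).+1 < ladder_dist u v)
          (packing_coloring (circular_ladder n) pi).
Proof.
apply: (iffP 'forall_forallP) => [Hpi u v neq_uv eq_pi|Hpi u v].
  have /implyP := Hpi u v; rewrite gdist_ladder; apply.
  rewrite neq_uv eq_pi eqxx /=; have [p [up <- _]] := ladder_dist_walk u v.
  by apply/connectP; exists p.
by apply/implyP=> /and3P[neq_uv /eqP eq_pi _]; rewrite gdist_ladder Hpi.
Qed.

Lemma packing_colorable_widen (T : finType) (e : rel T) k k' :
  k <= k' -> packing_colorable e k -> packing_colorable e k'.
Proof.
move=> le_kk' /existsP[pi /'forall_forallP Hpi]; apply/existsP.
exists [ffun u => widen_ord le_kk' (pi u)]; apply/'forall_forallP => u v.
rewrite !ffunE; have := Hpi u v; congr (_ ==> _).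
Qed.

(** Colourability is monotone in the number of colours, so failure at [k] excludes every smaller
    number. *)
Lemma packing_chromaticE (T : finType) (e : rel T) k :
  packing_colorable e k.+1 -> ~~ packing_colorable e k ->
  packing_chromatic e = k.+1.
Proof.
move=> colk ncolk; rewrite /packing_chromatic.
case: ex_minnP => m colm /(_ _ colk) le_mk; apply/eqP; rewrite eqn_leq le_mk.
by rewrite ltnNge; apply: contra ncolk => /packing_colorable_widen; apply.
Qed.

(** * Colourings as sequences of columns *)

(* The entries of a column are its colours in the rows u and v; c stands for the
   colour c + 1, as in packing_coloring. *)
Notation column := (nat * nat)%type.

Definition columns (k : nat) : seq column :=
  [seq x <- [seq (a, b) | a <- iota 0 k, b <- iota 0 k] | x.1 != x.2].

(** Here [d] is the distance along the cycle, so entries in different rows are [d.+1] apart. *)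
Definition separated (d : nat) (x y : column) : bool :=
  [&& (x.1 != y.1) || (x.1.+1 < d), (x.1 != y.2) || (x.1.+1 < d.+1),
      (x.2 != y.1) || (x.2.+1 < d.+1) & (x.2 != y.2) || (x.2.+1 < d)].

Definition entry (x : column) (r : bool) : nat := if r then x.2 else x.1.

Lemma separatedP (d : nat) (x y : column) :
  reflect (forall r s, entry x r = entry y s -> (entry x r).+1 < d + (r != s))
          (separated d x y).
Proof.
apply: (iffP and4P) => [[h1 h2 h3 h4] [] [] /= /eqP E|H].
- by move: h4; rewrite E addn0.
- by move: h3; rewrite E addn1.
- by move: h2; rewrite E addn1.
- by move: h1; rewrite E addn0.
split; rewrite -implybE; apply/implyP => /eqP.
- by move=> /(H false false); rewrite addn0.
- by move=> /(H false true); rewrite addn1.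
- by move=> /(H true false); rewrite addn1.
- by move=> /(H true true); rewrite addn0.
Qed.

Lemma separated_sym d x y : separated d x y = separated d y x.
Proof.
by apply/separatedP/separatedP => H r s E; rewrite E eq_sym; apply: H.
Qed.

Lemma separated_leq d d' x y : d <= d' -> separated d x y -> separated d' x y.
Proof.
move=> le_d /separatedP H; apply/separatedP => r s /H /leq_trans; apply.
by rewrite leq_add2r.
Qed.

Lemma columnsP k (x : column) :
  reflect [/\ x.1 < k, x.2 < k & x.1 != x.2] (x \in columns k).
Proof.
rewrite mem_filter andbC; apply: (iffP andP) => [[/allpairsP[[a b] /=]]|[]].
  by rewrite !mem_iota => -[lt_a lt_b ->].
case: x => a b /= lt_a lt_b neq_ab; split=> //.
by apply/allpairsP; exists (a, b); rewrite !mem_iota.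
Qed.

Lemma separated_far k d x y : x \in columns k -> k < d -> separated d x y.
Proof.
case/columnsP=> lt1 lt2 _ lt_kd; apply/separatedP => r s _.
by apply: ltn_addr; case: r => /=; lia.
Qed.

Lemma ladder_coloringP n k :
  reflect (exists f : 'I_n -> column,
             (forall i, f i \in columns k) /\
             (forall i j : 'I_n, i < j ->
                separated (minn (j - i) (n - (j - i))) (f i) (f j)))
          (packing_colorable (circular_ladder n) k).
Proof.
apply: (iffP existsP) => [[pi /ladder_packingP Hpi]|[f [fk sep]]].
  exists (fun i => (val (pi (i, false)), val (pi (i, true)))); split=> [i|i j lt_ij].
    apply/columnsP; split; [exact: ltn_ord | exact: ltn_ord |].
    apply/eqP => /val_inj /(Hpi (i, false) (i, true)).
    rewrite xpair_eqE andbF /ladder_dist /cycle_dist /= !subnn min0n.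
    by move=> /(_ isT).
  apply/separatedP => r s E; have {}E : pi (i, r) = pi (j, s).
    by apply/val_inj; move: E; case: r; case: s.
  have neq : (i, r) != (j, s).
    by rewrite xpair_eqE negb_and -val_eqE neq_ltn lt_ij.
  have := Hpi _ _ neq E; rewrite /ladder_dist /cycle_dist /=.
  have -> : i - j + (j - i) = j - i by lia.
  by case: (r).
have lt_entry i r : entry (f i) r < k by case/columnsP: (fk i); case: r.
exists [ffun v => Ordinal (lt_entry v.1 v.2)]; apply/ladder_packingP.
have sep2 (u v : 'I_n * bool) : u.1 < v.1 -> entry (f u.1) u.2 = entry (f v.1) v.2 ->
    (entry (f u.1) u.2).+1 < ladder_dist u v.
  move=> lt_uv; have /separatedP H := sep _ _ lt_uv; move=> /H.
  rewrite /ladder_dist /cycle_dist.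
  by have -> : u.1 - v.1 + (v.1 - u.1) = v.1 - u.1 by lia.
move=> u v neq_uv; rewrite !ffunE => /(congr1 val) /= E.
have [lt_uv|lt_vu|eq_uv] := ltngtP u.1 v.1; first exact: sep2.
  rewrite E; have := sep2 v u lt_vu (esym E).
  by rewrite /ladder_dist /cycle_dist [v.1 - u.1 + _]addnC [v.2 == _]eq_sym.
case: u v neq_uv E eq_uv => [i r] [j s] /= neq_uv + /val_inj eq_ij.
rewrite -{}eq_ij xpair_eqE eqxx /= in neq_uv *.
by case/columnsP: (fk i) => _ _; case: r s neq_uv => [] [] //= _ + E; rewrite E eqxx.
Qed.

(** * Exhaustive search, column by column *)

(* w lists the columns chosen so far, the most recent first.  Conditionals
   replace [&&], both arguments of which vm_compute would evaluate. *)
Fixpoint extendable (T : Type) (dom : seq T) (ok : seq T -> T -> bool)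
    (m : nat) (w : seq T) : bool :=
  if m is m'.+1 then
    has (fun c => if ok w c then extendable dom ok m' (c :: w) else false) dom
  else true.

(** The search can follow the prefixes of [f], so a search that returns [false] rules out every such
    [f]. *)
Lemma extendable_complete (T : eqType) (dom : seq T)
    (ok : seq T -> T -> bool) m (f : nat -> T) :
  (forall i, i < m -> f i \in dom) ->
  (forall i, i < m -> ok (rev (mkseq f i)) (f i)) ->
  extendable dom ok m [::].
Proof.
move=> fdom fok; rewrite -[[::]]/(rev (mkseq f 0)).
suff H a b : a + b = m -> extendable dom ok a (rev (mkseq f b)).
  by apply: H; rewrite addn0.
elim: a b => //= a IHa b mE; have lt_bm : b < m by rewrite -mE; lia.
apply/hasP; exists (f b); first exact: fdom.
rewrite fok //=; have := IHa b.+1; rewrite /mkseq -addn1 iotaD map_cat rev_cat /=.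
by apply; lia.
Qed.

(** [t] is the index gap between [c] and the head of [w]; [dist] turns gaps into distances: [id] on
    the infinite ladder, the shorter arc on a ring. *)
Fixpoint fits (dist : nat -> nat) (t : nat) (w : seq column) (c : column) : bool :=
  if w is x :: w' then
    if separated (dist t) x c then fits dist t.+1 w' c else false else true.

Lemma fits_nth dist w c t :
  (forall s, s < size w -> separated (dist (t + s)) (nth (0, 0) w s) c) ->
  fits dist t w c.
Proof.
elim: w t => //= x w IHw t H; rewrite -{1}[t]addn0 (H 0) //=.
by apply: IHw => s lt_s; rewrite addSnnS; apply: (H s.+1).
Qed.

Lemma fits_mkseq dist (f : nat -> column) i :
  (forall j, j < i -> separated (dist (i - j)) (f j) (f i)) ->
  fits dist 1 (rev (mkseq f i)) (f i).
Proof.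
move=> H; apply: fits_nth => s; rewrite size_rev size_mkseq => lt_si.
rewrite nth_rev size_mkseq // nth_mkseq ?add1n; last by lia.
have lt_i : i - s.+1 < i by lia.
by have := H _ lt_i; rewrite subKn.
Qed.

Definition ladder_search (k n : nat) : bool :=
  extendable (columns k) (fits (fun t => minn t (n - t)) 1) n [::].

Lemma ladder_search_complete k n :
  packing_colorable (circular_ladder n) k -> ladder_search k n.
Proof.
case/ladder_coloringP=> f [fk sep]; case: n f fk sep => [|n] f fk sep; first by [].
apply: (@extendable_complete _ _ _ _ (fun i => f (inord i))) => i lt_in //.
apply: fits_mkseq => j lt_ji; have := sep (inord j) (inord i).
by rewrite !inordK //; [apply | lia].
Qed.

(** * Lower bounds through the infinite ladder *)

Lemma ladder_unroll k n :
  k < n -> packing_colorable (circular_ladder n) k ->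
  exists f : nat -> column,
    [/\ forall i, f i \in columns k, forall i, f (i + n) = f i
      & forall i j, i < j -> separated (j - i) (f i) (f j)].
Proof.
move=> lt_kn /ladder_coloringP[f [fk sep]].
have n_gt0 : 0 < n by lia.
pose ix i := Ordinal (ltn_pmod i n_gt0).
exists (fun i => f (ix i)); split=> [i|i|i j lt_ij]; first exact: fk.
  by congr f; apply: val_inj; rewrite /= modnDr.
have [lt_i lt_j] : i %% n < n /\ j %% n < n by rewrite !ltn_pmod.
have [q iE] : exists q, i = q * n + i %% n by exists (i %/ n); apply: divn_eq.
have [q' jE] : exists q', j = q' * n + j %% n by exists (j %/ n); apply: divn_eq.
(* The gap [j - i] is at least one of the two arcs between the residues; for equal residues it is at
   least [n], beyond the reach of any of the [k] colours. *)
have [lt_m|lt_m|eq_m] := ltngtP (i %% n) (j %% n).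
- apply: separated_leq (sep (ix i) (ix j) lt_m) => /=.
  rewrite geq_min; apply/orP; left.
  move: (i %% n) (j %% n) => r r' in lt_i lt_j iE jE lt_m *.
  have : q <= q' by nia.
  by nia.
- rewrite separated_sym; apply: separated_leq (sep (ix j) (ix i) lt_m) => /=.
  rewrite geq_min; apply/orP; right.
  move: (i %% n) (j %% n) => r r' in lt_i lt_j iE jE lt_m *.
  have : q < q' by nia.
  by nia.
- apply: (separated_far (k := k)); first exact: fk.
  move: (i %% n) (j %% n) => r r' in lt_i lt_j iE jE eq_m *.
  have : q < q' by nia.
  by nia.
Qed.

(** After unrolling, a single search of fixed length settles all [n > 4]. *)
Lemma ladder_not_4 n : 4 < n -> ~~ packing_colorable (circular_ladder n) 4.
Proof.
move=> lt4n; apply/negP => /(ladder_unroll lt4n)[f [fk _ sep]].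
suff: extendable (columns 4) (fits id 1) 6 [::] by vm_compute.
apply: (@extendable_complete _ _ _ _ f) => // i _.
by apply: fits_mkseq => j; apply: sep.
Qed.

(* Colour 1 is encoded by 0.  In a 5-colouring every column without colour 1
   lies between two columns that have it in the same row; it is given the
   opposite row, so that the row alternates all along the ladder. *)
Definition colour1_row (x y : column) : bool :=
  (x.2 == 0) || ((x.1 != 0) && (y.1 == 0)).

(* The pattern triggers only on four chosen columns, so that the failure sits in
   the middle (columns 2, 3, 4) of the seven-column window searched below. *)
Definition not_alternating (w : seq column) (c : column) : bool :=
  if w is [:: y; x; _; _] then colour1_row x y == colour1_row y c else true.

Lemma ladder_5_even n :
  5 < n -> packing_colorable (circular_ladder n) 5 -> ~~ odd n.
Proof.
move=> lt5n /(ladder_unroll lt5n)[f [fk fn sep]].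
(* The shift by 2 puts the columns compared by [r i] and [r i.+1] in the middle of the window of
   seven columns starting at [i]. *)
pose r i := colour1_row (f (i + 2)) (f (i + 3)).
have rS i : r i.+1 = ~~ r i.
  case: (r i.+1 =P ~~ r i) => // rE_neg.
  have rE : r i = r i.+1 by case: (r i) (r i.+1) rE_neg => [] [].
  rewrite /r !addSn !addnS !addn0 in rE.
  suff: extendable (columns 5)
    (fun w c => if fits id 1 w c then not_alternating w c else false) 7 [::].
    by vm_compute.
  apply: (@extendable_complete _ _ _ _ (fun t => f (i + t))) => // t lt_t.
  rewrite fits_mkseq => [|j lt_jt].
    case: t lt_t => [|[|[|[|[|[|[|t]]]]]]] //= _.
    by rewrite !addnS addn0; apply/eqP.
  by have := sep (i + j) (i + t); rewrite subnDl ltn_add2l; apply.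
have rn m : r m = r 0 (+) odd m.
  by elim: m => [|m IHm]; rewrite ?addbF // rS IHm /= addbN.
(* Periodicity of [f] meets alternation: [r] returns to its value after [n] flips, so [n] is
   even. *)
have rn0 : r n = r 0 by rewrite /r ![n + _]addnC !fn.
by have := rn n; rewrite rn0; case: (r 0); case: (odd n).
Qed.

(** * Upper bounds from words of columns *)

Definition spaced (dist : nat -> nat) (s : seq column) : bool :=
  all (fun j => all (fun i => separated (dist (j - i)) (nth (0, 0) s i) (nth (0, 0) s j))
                 (iota 0 j)) (iota 0 (size s)).

Lemma spacedP dist s :
  reflect (forall i j, i < j -> j < size s ->
             separated (dist (j - i)) (nth (0, 0) s i) (nth (0, 0) s j))
          (spaced dist s).
Proof.
apply: (iffP allP) => [H i j lt_ij lt_j|H j].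
  have /H/allP : j \in iota 0 (size s) by rewrite mem_iota.
  by apply; rewrite mem_iota.
rewrite mem_iota => /= lt_j; apply/allP => i; rewrite mem_iota => /= lt_ij.
exact: H.
Qed.

Lemma ladder_word k s :
  all (mem (columns k)) s -> spaced (fun t => minn t (size s - t)) s ->
  packing_colorable (circular_ladder (size s)) k.
Proof.
move=> /allP sk /spacedP sep; apply/ladder_coloringP.
exists (fun i => nth (0, 0) s i); split=> [i|i j lt_ij].
  by apply: sk; apply: mem_nth.
exact: sep.
Qed.

Definition seam : seq column := [:: (0, 2); (4, 0); (0, 1); (2, 0); (0, 3); (1, 0)].

(* A ring of words that all start with the seam is valid as soon as each word
   followed by the seam is, because colours at most 6 only constrain columns at
   distance at most 6, the length of the seam. *)
Definition block (k : nat) (s : seq column) : bool :=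
  [&& all (mem (columns k)) s, prefix seam s & spaced id (s ++ seam)].

(** Two columns lie both in [s' ++ seam], or both in [s ++ seam] since [s'] starts with the seam, or
    more than 6 apart. *)
Lemma block_cat k s s' : k <= 6 -> block k s -> block k s' -> block k (s ++ s').
Proof.
move=> le_k6 /and3P[sk /prefixP[t sE] /spacedP sep].
move=> /and3P[s'k /prefixP[t' s'E] /spacedP sep'].
apply/and3P; split; first by rewrite all_cat sk.
  by rewrite sE -catA prefix_prefix.
apply/spacedP => i j lt_ij; rewrite !size_cat => lt_j.
rewrite -catA in lt_ij *; have [le_i|lt_i] := leqP (size s) i.
  have le_j := leq_trans le_i (ltnW lt_ij).
  rewrite nth_cat [nth _ _ j]nth_cat !ltnNge le_i le_j /=.
  have -> : j - i = (j - size s) - (i - size s) by lia.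
  by apply: sep'; rewrite ?size_cat; lia.
have [lt_j6|le_j] := ltnP j (size s + size seam).
  have := sep i j lt_ij; rewrite size_cat => /(_ lt_j6).
  rewrite s'E -catA catA [nth _ ((s ++ _) ++ _) i]nth_cat.
  by rewrite [nth _ ((s ++ _) ++ _) j]nth_cat !size_cat lt_j6 (ltn_trans lt_ij).
apply: (separated_far (k := k)); last by move: le_j; rewrite /=; lia.
by rewrite nth_cat lt_i; apply: (allP sk); apply: mem_nth.
Qed.

Lemma ladder_block k s :
  k <= 6 -> block k s -> packing_colorable (circular_ladder (size s)) k.
Proof.
move=> le_k6 /and3P[sk /prefixP[t sE] /spacedP sep]; apply: ladder_word => //.
apply/spacedP => i j lt_ij lt_j.
have col i' : i' < size s -> nth (0, 0) s i' \in columns k.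
  by move=> lt_i'; apply: (allP sk); apply: mem_nth.
have lt_i := ltn_trans lt_ij lt_j.
have sep1 := sep i j lt_ij; rewrite !nth_cat lt_i lt_j size_cat in sep1.
have [le_d|lt_d] := leqP (j - i) (size s - (j - i)).
  by apply: sep1; lia.
have [lt_k|le_k] := ltnP k (size s - (j - i)).
  exact: separated_far (col _ lt_i) lt_k.
(* The arc through the end of [s] has length at most 6, so column [i] lies in the seam and reappears
   at [size s + i] in [s ++ seam]. *)
have lt_i6 : i < size seam by rewrite /=; lia.
have wrap : nth (0, 0) (s ++ seam) (size s + i) = nth (0, 0) s i.
  by rewrite nth_cat ltnNge leq_addr /= addKn sE nth_cat lt_i6.
have := sep j (size s + i); rewrite size_cat ltn_add2l => /(_ _ lt_i6).
rewrite wrap nth_cat lt_j separated_sym.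
have -> : size s + i - j = size s - (j - i) by lia.
by apply; lia.
Qed.

Definition block_length (k n : nat) : Prop := exists2 s, block k s & size s = n.

Lemma block_lengthD k m n :
  k <= 6 -> block_length k m -> block_length k n -> block_length k (m + n).
Proof.
move=> le_k6 [s bs <-] [s' bs' <-]; exists (s ++ s'); last exact: size_cat.
exact: block_cat.
Qed.

Lemma block_length6 k : 5 <= k <= 6 -> block_length k 6.
Proof.
by move=> k56; exists seam => //; have [->|->] : k = 5 \/ k = 6 by lia.
Qed.

Lemma block_length_add6 k m q :
  5 <= k <= 6 -> block_length k m -> block_length k (m + 6 * q).
Proof.
move=> k56 Lm; elim: q => [|q IHq]; first by rewrite muln0 addn0.
rewrite mulnS addnCA; apply: block_lengthD => //; first by case/andP: k56.
exact: block_length6.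
Qed.

Lemma ladder_even_5 n :
  5 < n -> ~~ odd n -> n \notin [:: 8; 14] ->
  packing_colorable (circular_ladder n) 5.
Proof.
move=> lt5n even_n; rewrite !inE => n_ne.
suff [s bs <-] : block_length 5 n by apply: ladder_block bs.
have L10 : block_length 5 10.
  by exists [:: (0, 2); (4, 0); (0, 1); (2, 0); (0, 3); (1, 0); (0, 4); (2, 0);
                (0, 1); (3, 0)].
have L20 : block_length 5 (10 + 10) by apply: block_lengthD.
(* These are the residues 0, 4 and 2 modulo 6; the last starts only at 20, which is why 8 and 14 are
   excluded. *)
have [q [E|[E|E]]] : exists q, n = 6 + 6 * q \/ n = 10 + 6 * q \/ n = 20 + 6 * q.
  have [r0|r0] := eqVneq (n %% 6) 0; first by exists (n %/ 6 - 1); lia.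
  have [r4|r4] := eqVneq (n %% 6) 4; first by exists (n %/ 6 - 1); lia.
  by exists (n %/ 6 - 3); lia.
- by rewrite E; apply: block_length_add6 => //; apply: block_length6.
- by rewrite E; apply: block_length_add6.
- by rewrite E; apply: block_length_add6.
Qed.

Lemma ladder_6 n :
  (10 < n) && odd n || (n == 14) -> packing_colorable (circular_ladder n) 6.
Proof.
move=> n_ok; suff [s bs <-] : block_length 6 n by apply: ladder_block bs.
case/orP: n_ok => [/andP[lt10n odd_n]|/eqP->]; last first.
  by exists [:: (0, 2); (4, 0); (0, 1); (2, 0); (0, 3); (1, 0); (0, 5); (2, 0);
                (0, 1); (3, 0); (0, 4); (2, 0); (0, 1); (5, 0)].
have L11 : block_length 6 11.
  by exists [:: (0, 2); (4, 0); (0, 1); (2, 0); (0, 3); (1, 0); (0, 4); (2, 0);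
                (0, 1); (3, 0); (1, 5)].
have L13 : block_length 6 13.
  by exists [:: (0, 2); (4, 0); (0, 1); (2, 0); (0, 3); (1, 0); (0, 5); (4, 2);
                (1, 0); (0, 3); (2, 0); (0, 1); (5, 0)].
have L15 : block_length 6 15.
  by exists [:: (0, 2); (4, 0); (0, 1); (2, 0); (0, 3); (1, 0); (0, 5); (2, 0);
                (0, 1); (3, 0); (0, 2); (1, 4); (5, 0); (0, 1); (3, 0)].
(* The three odd residues modulo 6. *)
have [q [E|[E|E]]] : exists q, n = 11 + 6 * q \/ n = 13 + 6 * q \/ n = 15 + 6 * q.
  have [r5|r5] := eqVneq (n %% 6) 5; first by exists (n %/ 6 - 1); lia.
  by exists (n %/ 6 - 2); lia.
all: by rewrite E; apply: block_length_add6.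
Qed.

Theorem theorem7 (n : nat) (hn : 3 <= n) :
  packing_chromatic (circular_ladder n) =
    if (n == 3) || (~~ odd n && (n \notin [:: 8; 14])) then 5
    else if n \in [:: 7; 8; 9] then 7
    else 6.
Proof.
have not_search k m : ladder_search k m = false ->
    ~~ packing_colorable (circular_ladder m) k.
  by move=> Hf; apply: contraFN Hf; apply: ladder_search_complete.
case: ifP => [n5|/negbT].
  have [lt5n|le_n5] := ltnP 5 n.
    apply: packing_chromaticE; last by apply: ladder_not_4; lia.
    by case/orP: n5 => [/eqP|/andP[]]; [lia | apply: ladder_even_5].
  (* Unrolling with four colours requires [n > 4], so these two lengths are searched directly. *)
  have {hn n5 le_n5} [->|->] : n = 3 \/ n = 4 by move: n5; rewrite !inE; lia.
    apply: packing_chromaticE; last by apply: not_search; vm_compute.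
    exact: (@ladder_word 5 [:: (0, 1); (2, 0); (3, 4)]).
  apply: packing_chromaticE; last by apply: not_search; vm_compute.
  exact: (@ladder_word 5 [:: (0, 1); (2, 0); (0, 3); (4, 0)]).
rewrite !inE => not5; case: ifP => [|not7].
  case/or3P=> /eqP->; (apply: packing_chromaticE;
    last by apply: not_search; vm_compute).
  - exact: (@ladder_word 7 [:: (0, 1); (2, 0); (0, 3); (1, 0); (0, 2); (4, 0); (5, 6)]).
  - exact: (@ladder_word 7 [:: (0, 1); (2, 0); (0, 3); (1, 0); (0, 2); (4, 0);
                               (0, 5); (6, 0)]).
  - exact: (@ladder_word 7 [:: (0, 1); (2, 0); (0, 3); (1, 0); (0, 2); (4, 0);
                               (0, 1); (3, 0); (5, 6)]).
have [->|n_ne5] := eqVneq n 5.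
  apply: packing_chromaticE; last by apply: not_search; vm_compute.
  exact: (@ladder_word 6 [:: (0, 1); (2, 0); (0, 3); (1, 0); (4, 5)]).
apply: packing_chromaticE; first by apply: ladder_6; lia.
(* Parity does not exclude five colours on the even length 14; a search does. *)
have [->|n_ne14] := eqVneq n 14; first by apply: not_search; vm_compute.
by apply/negP => /ladder_5_even; lia.
Qed.
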